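(* Let $n>k\ge 1$, let $X$ be a non-random real $n\times k$ matrix of rank $k$, $\beta\in\mathbb{R}^k$, and $Y=X\beta+\varepsilon$, where the random vector $\varepsilon\in\mathbb{R}^n$ is normally distributed with $E(\varepsilon)=0$ and $\operatorname{cov}(\varepsilon)=\sigma^2 I_n$, $\sigma^2>0$. Let $\lambda_1$ be the maximum eigenvalue of $(X^TX)^{-1}$ and $z_1$ ($z_1^Tz_1=1$) a normalized eigenvector corresponding to it. Then the optimal quasi-estimator $$\tilde b_o=b-\operatorname{sign}(z_1^T\delta)\,\sqrt{\frac{\lambda_1}{\pi}}\;\frac{\Gamma((n-k+1)/2)}{\Gamma((n-k+2)/2)}\,\sqrt{e^Te}\;z_1$$ is unbiased, i.e. $E(\tilde b_o)=\beta$.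
   Context: The OLS-estimator is $b=(X^TX)^{-1}X^TY$; its random error is $\delta=b-\beta=(X^TX)^{-1}X^T\varepsilon$; the residual vector is $e=Y-Xb$. The sign function is $\operatorname{sign}(x)=1$ if $x\ge 0$ and $\operatorname{sign}(x)=-1$ if $x<0$. All square roots are nonnegative. $\Gamma$ is the gamma-function, $I_n$ the $n\times n$ identity matrix and $\operatorname{cov}(\varepsilon)$ the variance-covariance matrix. *)

(* Defs.v *)
From HB Require Import structures.
From mathcomp Require Import all_boot all_order all_algebra.
From mathcomp Require Import all_classical all_reals all_analysis.

Set Implicit Arguments.
Unset Strict Implicit.
Unset Printing Implicit Defensive.

Import Order.TTheory GRing.Theory Num.Theory.
Import numFieldNormedType.Exports.

Local Open Scope classical_set_scope.
Local Open Scope ring_scope.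

(* Unlike [Num.sg], the value at 0 is 1. *)
Definition sign1 (R : realType) (x : R) : R := if 0 <= x then 1 else -1.

(* Meaningful for [0 < x], where the integral converges. *)
Definition Gamma (R : realType) (x : R) : R :=
  \int[@lebesgue_measure R]_(t in `]0, +oo[) (t `^ (x - 1) * expR (- t)).

(* [eigenvalue] is phrased with row eigenvectors; row and column eigenvectors
   of a square matrix have the same eigenvalues. *)
Definition max_eigenvalue (R : realType) (k : nat) (M : 'M[R]_k) (a : R) :=
  eigenvalue M a /\ forall c : R, eigenvalue M c -> c <= a.

Definition vcoord (R : realType) (T : Type) (n : nat) (V : T -> 'cV[R]_n)
  (i : 'I_n) : T -> R := fun w => V w i 0.

Definition random_vector (R : realType) (d : measure_display)
    (T : measurableType d) (n : nat) (V : T -> 'cV[R]_n) :=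
  forall i : 'I_n, measurable_fun [set: T] (vcoord V i).

(* Integrability is explicit because [expectation] is a total operator. *)
Definition has_mean (R : realType) (d : measure_display)
    (T : measurableType d) (P : probability T R) (n : nat)
    (V : T -> 'cV[R]_n) (m : 'cV[R]_n) :=
  forall i : 'I_n, P.-integrable [set: T] (EFin \o vcoord V i) /\
                   'E_P[vcoord V i]%E = (m i 0)%:E.

Definition has_cov (R : realType) (d : measure_display)
    (T : measurableType d) (P : probability T R) (n : nat)
    (V : T -> 'cV[R]_n) (S : 'M[R]_n) :=
  forall i j : 'I_n, covariance P (vcoord V i) (vcoord V j) = (S i j)%:E.

Definition mutually_independent (R : realType) (d : measure_display)
    (T : measurableType d) (P : probability T R) (l : nat)
    (Z : T -> 'cV[R]_l) :=
  forall (J : {set 'I_l}) (B : 'I_l -> set R),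
    (forall i, measurable (B i)) ->
    P (\bigcap_(i in [set` J]) (vcoord Z i @^-1` B i)) =
    (\prod_(i in J) P (vcoord Z i @^-1` B i))%E.

Definition standard_normal_vector (R : realType) (d : measure_display)
    (T : measurableType d) (P : probability T R) (l : nat)
    (Z : T -> 'cV[R]_l) :=
  [/\ random_vector Z,
      mutually_independent P Z &
      forall (i : 'I_l) (B : set R), measurable B ->
        P (vcoord Z i @^-1` B) = normal_prob 0 1 B].

(* Borel sets of R^n are the measurable sets of [n.-tuple R]. *)
Definition cV_tuple (R : realType) (n : nat) (v : 'cV[R]_n) : n.-tuple R :=
  [tuple v i 0 | i < n].

Definition same_law (R : realType) (d d' : measure_display)
    (T : measurableType d) (T' : measurableType d')
    (P : probability T R) (Q : probability T' R) (n : nat)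
    (V : T -> 'cV[R]_n) (W : T' -> 'cV[R]_n) :=
  forall B : set (n.-tuple R), measurable B ->
    P [set w | B (cV_tuple (V w))] = Q [set w | B (cV_tuple (W w))].

(* A random vector is (multivariate) normal when it is distributed as an affine
   image of a vector of independent N(0,1) variables, which may live on another
   probability space; singular normal laws are included. *)
Definition normal_vector (R : realType) (d : measure_display)
    (T : measurableType d) (P : probability T R) (n : nat)
    (V : T -> 'cV[R]_n) :=
  random_vector V /\
  exists (l : nat) (m : 'cV[R]_n) (A : 'M[R]_(n, l))
    (d' : measure_display) (T' : measurableType d') (Q : probability T' R)
    (Z : T' -> 'cV[R]_l),
    standard_normal_vector Q Z /\
    same_law P Q V (fun w => m + A *m Z w).

Definition ols (R : realType) (n k : nat) (X : 'M[R]_(n, k)) (y : 'cV[R]_n) :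
  'cV[R]_k := invmx (X^T *m X) *m X^T *m y.

Definition residual (R : realType) (n k : nat) (X : 'M[R]_(n, k))
  (y : 'cV[R]_n) : 'cV[R]_n := y - X *m ols X y.

Definition optimal_quasi_estimator (R : realType) (n k : nat)
    (X : 'M[R]_(n, k)) (beta : 'cV[R]_k) (lambda1 : R) (z1 : 'cV[R]_k)
    (y : 'cV[R]_n) : 'cV[R]_k :=
  let b := ols X y in
  let delta := b - beta in
  let e := residual X y in
  b - (sign1 ((z1^T *m delta) 0 0) * Num.sqrt (lambda1 / pi)
       * (Gamma ((n - k + 1)%N%:R / 2) / Gamma ((n - k + 2)%N%:R / 2))
       * Num.sqrt ((e^T *m e) 0 0)) *: z1.

(* Main.v *)
Require Import Defs.
From HB Require Import structures.
From mathcomp Require Import all_boot all_order all_algebra.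
From mathcomp Require Import all_classical all_reals all_analysis.
From mathcomp Require Import measurable_realfun.

(** The estimator is linear in the noise up to one term: with
    [H = (X^T X)^-1 X^T] and [M = 1 - X H], the error is [delta = H eps], the
    residual is [M eps], and

      estimator = beta + H eps - K * sign1 (c eps) * |M eps| *: z1,

    where [c = z1^T H] and [K] is a constant. The mean of [beta + H eps] is
    [beta], so everything rests on [E (sign1 (c eps) * |M eps|) = 0]. This is a
    symmetry fact: the function [v |-> sign1 (c v) * |M v|] is odd away from the
    hyperplane [c v = 0], and [eps] and [- eps] have the same law.

    The symmetry of [eps] (centered_normal_sym) comes from the symmetry of the
    one-dimensional standard normal law, carried first to vectors with
    independent coordinates, because a finite measure on tuples is determined by
    its values on boxes (tuple_measure_unique), and then to their linear images.

    As [sign1 0 = 1], oddness fails on the hyperplane [c v = 0], which must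
    therefore be null (centered_normal_hyperplane). Write [eps] in law as
    [A Z]. If [c A <> 0], some coordinate [Z_j] has a nonzero coefficient in
    [c A Z]; replacing [Z_j] by an independent copy does not change the law of
    [Z] (standard_normal_resample), and given the other coordinates a single
    value of the copy satisfies the equation (standard_normal_hyperplane).
    If [c A = 0], then [c eps] vanishes almost surely, which contradicts
    [cov eps = sigma2 *: 1%:M] and [c <> 0] (cov_not_degenerate). *)

Set Implicit Arguments.
Unset Strict Implicit.
Unset Printing Implicit Defensive.

Import Order.TTheory GRing.Theory Num.Theory.
Import numFieldNormedType.Exports.

Local Open Scope classical_set_scope.
Local Open Scope ring_scope.

(** * Laws of random vectors *)

Definition tuple_cV {R : realType} {n : nat} (t : n.-tuple R) : 'cV[R]_n :=
  \col_i tnth t i.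

Definition box {R : realType} {n : nat} (B : 'I_n -> set R) : set 'cV[R]_n :=
  [set v | forall i, B i (v i 0)].

Lemma cV_tupleK {R : realType} {n : nat} :
  cancel (@cV_tuple R n) (@tuple_cV R n).
Proof. by move=> v; apply/colP => i; rewrite !mxE tnth_mktuple. Qed.

Lemma measurable_cV_tuple (R : realType) (d : measure_display)
    (T : measurableType d) (n : nat) (V : T -> 'cV[R]_n) :
  random_vector V -> measurable_fun [set: T] (fun w => cV_tuple (V w)).
Proof.
move=> mV; apply/measurable_fun_tnthP => i.
by apply: (eq_measurable_fun (vcoord V i)) => // w _ /=; rewrite tnth_mktuple.
Qed.

(** The universal random vector: a function of column vectors is Borel on tuples
    as soon as it sends every random vector to a measurable function. *)
Lemma random_vector_tuple_cV (R : realType) (n : nat) :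
  random_vector (@tuple_cV R n).
Proof.
move=> i; apply: (eq_measurable_fun (@tnth n R ^~ i)); last exact: measurable_tnth.
by move=> t _; rewrite /vcoord mxE.
Qed.

Lemma random_vector_mulmx (R : realType) (d : measure_display)
    (T : measurableType d) (m n : nat) (A : 'M[R]_(m, n)) (V : T -> 'cV[R]_n) :
  random_vector V -> random_vector (fun w => A *m V w).
Proof.
move=> mV i.
apply: (@eq_measurable_fun _ _ _ _ _ (fun w => \sum_j A i j * vcoord V j w)).
  by move=> w _; rewrite /vcoord mxE.
apply: measurable_sum => j; apply: measurable_funM => //; exact: mV.
Qed.

Lemma random_vectorD (R : realType) (d : measure_display)
    (T : measurableType d) (n : nat) (V W : T -> 'cV[R]_n) :
  random_vector V -> random_vector W -> random_vector (fun w => V w + W w).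
Proof.
move=> mV mW i.
apply: (@eq_measurable_fun _ _ _ _ _ (vcoord V i \+ vcoord W i)).
  by move=> w _; rewrite /vcoord /= mxE.
exact: measurable_funD.
Qed.

Lemma random_vectorN (R : realType) (d : measure_display)
    (T : measurableType d) (n : nat) (V : T -> 'cV[R]_n) :
  random_vector V -> random_vector (fun w => - V w).
Proof.
move=> mV i; apply: (@eq_measurable_fun _ _ _ _ _ (\- vcoord V i)).
  by move=> w _; rewrite /vcoord /= mxE.
by apply: measurableT_comp.
Qed.

Lemma random_vector_cst (R : realType) (d : measure_display)
    (T : measurableType d) (n : nat) (v : 'cV[R]_n) :
  random_vector (fun _ : T => v).
Proof. by move=> i; exact: measurable_cst. Qed.

Lemma preimage_box (R : realType) (T : Type) (n : nat) (V : T -> 'cV[R]_n)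
    (B : 'I_n -> set R) :
  [set w | box B (V w)] =
  \bigcap_(i in [set` [set: 'I_n]%SET]) (vcoord V i @^-1` B i).
Proof.
apply/seteqP; split => w /= h i; first by move=> _; exact: h.
by apply: h; rewrite /= inE.
Qed.

Lemma measurable_box (R : realType) (d : measure_display)
    (T : measurableType d) (n : nat) (V : T -> 'cV[R]_n) (B : 'I_n -> set R) :
  random_vector V -> (forall i, measurable (B i)) ->
  measurable [set w | box B (V w)].
Proof.
move=> mV mB; rewrite preimage_box.
apply: fin_bigcap_measurable => // i _; rewrite -[X in measurable X]setTI.
exact: mV.
Qed.

(** Boxes are stable under intersection and generate the measurable sets, and
    the whole space is a box: this is the pi-lambda theorem. *)
Lemma tuple_measure_unique (R : realType) (n : nat)
    (m1 m2 : {measure set (n.-tuple R) -> \bar R}) :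
  (m1 [set: n.-tuple R] < +oo)%E ->
  (forall B : 'I_n -> set R, (forall i, measurable (B i)) ->
    m1 [set t | box B (tuple_cV t)] = m2 [set t | box B (tuple_cV t)]) ->
  forall A, measurable A -> m1 A = m2 A.
Proof.
move=> fin1 m12.
pose G : set (set (n.-tuple R)) := [set A | exists2 B : 'I_n -> set R,
  (forall i, measurable (B i)) & A = [set t | box B (tuple_cV t)]].
have mG : G `<=` measurable.
  move=> _ [B mB ->].
  exact: measurable_box (@random_vector_tuple_cV R n) mB.
apply: (measure_unique G (fun _ => setT)) => //.
- apply/seteqP; split; last first.
    by apply: smallest_sub => //; exact: sigma_algebra_measurable.
  apply: smallest_sub; first exact: smallest_sigma_algebra.
  rewrite -bigcup_seq => _ [i _] /= [B mB <-]; apply: sub_sigma_algebra.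
  exists (fun j => if j == i then B else setT).
    by move=> j; case: eqP.
  rewrite setTI; apply/seteqP; split => t /=; rewrite /box /=.
    by move=> Bt j; case: eqP => // ->; rewrite mxE.
  by move=> /(_ i); rewrite eqxx mxE.
- move=> _ _ [B mB ->] [C mC ->]; exists (fun i => B i `&` C i).
    by move=> i; exact: measurableI.
  apply/seteqP; split => t /=; first by move=> [b c] i; split.
  by move=> h; split=> i; case: (h i).
- by move=> _; exists (fun=> setT) => //; apply/seteqP; split.
- by rewrite bigcup_const.
- by move=> _ [B mB ->]; exact: m12.
Qed.

Lemma same_law_box (R : realType) (d d' : measure_display)
    (T : measurableType d) (T' : measurableType d')
    (P : probability T R) (Q : probability T' R) (n : nat)
    (V : T -> 'cV[R]_n) (W : T' -> 'cV[R]_n) :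
  random_vector V -> random_vector W ->
  (forall B : 'I_n -> set R, (forall i, measurable (B i)) ->
    P [set w | box B (V w)] = Q [set w | box B (W w)]) ->
  same_law P Q V W.
Proof.
move=> /measurable_cV_tuple mV /measurable_cV_tuple mW PQ A mA.
pose V' : {mfun T >-> n.-tuple R} := mfun_Sub (mem_set mV).
pose W' : {mfun T' >-> n.-tuple R} := mfun_Sub (mem_set mW).
apply: (@tuple_measure_unique _ _ (pushforward P V') (pushforward Q W')) => //.
  by suff: (P [set: T] < +oo)%E by []; rewrite probability_setT ltry.
have V'E : tuple_cV \o V' = V by apply/funext => w; exact: cV_tupleK.
have W'E : tuple_cV \o W' = W by apply/funext => w; exact: cV_tupleK.
by move=> B mB; have := PQ B mB; rewrite -V'E -W'E.
Qed.

Lemma same_law_cV (R : realType) (d d' : measure_display)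
    (T : measurableType d) (T' : measurableType d')
    (P : probability T R) (Q : probability T' R) (n : nat)
    (V : T -> 'cV[R]_n) (W : T' -> 'cV[R]_n) (A : set 'cV[R]_n) :
  same_law P Q V W -> measurable [set t | A (tuple_cV t)] ->
  P [set w | A (V w)] = Q [set w | A (W w)].
Proof.
move=> PQ /PQ /=; congr (P _ = Q _); apply/seteqP.
  by split => w /=; rewrite cV_tupleK.
by split => w /=; rewrite cV_tupleK.
Qed.

(** * Standard normal vectors *)

(** The hypothesis on [s] excludes the convention by which [normal_prob 0 0] is
    the uniform law on [[0, 1]]. *)
Lemma normal_probN (R : realType) (s : R) (B : set R) :
  s != 0 -> measurable B ->
  normal_prob 0 s (-%R @^-1` B) = normal_prob 0 s B.
Proof.
move=> s0 mB; rewrite /normal_prob.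
have mpdf : measurable_fun setT (fun x : R => (normal_pdf 0 s x)%:E).
  by apply/measurable_EFinP; exact: measurable_normal_pdf.
transitivity (\int[pushforward (@lebesgue_measure R)
    (-%R : R -> measurableTypeR R)]_(x in B) (normal_pdf 0 s x)%:E)%E.
  rewrite ge0_integral_pushforward //=; last 2 first.
  - exact: measurable_funTS.
  - by move=> x _; rewrite lee_fin normal_pdf_ge0.
  apply: eq_integral => x _ /=.
  by rewrite !normal_pdfE// /normal_fun !subr0 sqrrN.
by apply: eq_measure_integral => A mA _; exact: lebesgue_measureN.
Qed.

Lemma standard_normal_box (R : realType) (d : measure_display)
    (T : measurableType d) (P : probability T R) (l : nat)
    (Z : T -> 'cV[R]_l) (B : 'I_l -> set R) :
  standard_normal_vector P Z -> (forall i, measurable (B i)) ->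
  P [set w | box B (Z w)] = (\prod_i normal_prob 0 1 (B i))%E.
Proof.
move=> [_ indepZ normZ] mB.
rewrite preimage_box indepZ//; apply: eq_big => [i|i _]; first by rewrite inE.
exact: normZ.
Qed.

Lemma standard_normal_sym (R : realType) (d : measure_display)
    (T : measurableType d) (P : probability T R) (l : nat)
    (Z : T -> 'cV[R]_l) :
  standard_normal_vector P Z -> same_law P P Z (fun w => - Z w).
Proof.
move=> stdZ; have [mZ _ _] := stdZ.
apply: same_law_box => // [|B mB]; first exact: random_vectorN.
have mNB i : measurable (-%R @^-1` B i).
  by rewrite -[X in measurable X]setTI; exact: oppr_measurable.
have -> : [set w | box B (- Z w)] = [set w | box (fun i => -%R @^-1` B i) (Z w)].
  by apply/seteqP; split => w /= h i; have := h i; rewrite mxE.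
rewrite !(standard_normal_box stdZ)//.
by apply: eq_bigr => i _; rewrite normal_probN// oner_neq0.
Qed.

Lemma random_vector_resample (R : realType) (d : measure_display)
    (T : measurableType d) (l : nat) (j : 'I_l) (Z : T -> 'cV[R]_l) :
  random_vector Z ->
  random_vector (fun wx : T * R => \col_i if i == j then wx.2 else Z wx.1 i 0).
Proof.
move=> mZ i; rewrite /vcoord; under eq_fun do rewrite mxE.
case: (i == j); first exact: measurable_snd.
exact: (measurableT_comp (mZ i) measurable_fst).
Qed.

(** The vector on the right lives on a product space: the first factor carries
    [Z], the second an independent standard normal variable put in place of the
    coordinate [j]. Both vectors give a box the product of the normal
    probabilities of its sides. *)
Lemma standard_normal_resample (R : realType) (d : measure_display)
    (T : measurableType d) (P : probability T R) (l : nat) (j : 'I_l)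
    (Z : T -> 'cV[R]_l) :
  standard_normal_vector P Z ->
  same_law P (P \x normal_prob 0 1)%E Z
    (fun wx : T * R => \col_i if i == j then wx.2 else Z wx.1 i 0).
Proof.
move=> stdZ; have [mZ _ _] := stdZ.
apply: same_law_box => // [|B mB]; first exact: random_vector_resample.
(* The box with its side [j] removed, which no longer constrains [Z_j]. *)
pose B' i := if i == j then setT else B i.
have mB' i : measurable (B' i) by rewrite /B'; case: ifP.
have -> : [set wx : T * R |
    box B (\col_i if i == j then wx.2 else Z wx.1 i 0)] =
    [set w | box B' (Z w)] `*` B j.
  apply/seteqP; split=> -[w x] /=.
    move=> h; split; last by have := h j; rewrite mxE eqxx.
    by move=> i; rewrite /B'; have := h i; rewrite mxE; case: ifP.
  move=> [h Bx] i; rewrite mxE; case: eqP => [->//|/eqP/negbTE ij].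
  by have := h i; rewrite /B' ij.
have mBZ : measurable [set w | box B' (Z w)] by exact: measurable_box.
rewrite [RHS]product_measure1E//; last exact: mB.
rewrite (standard_normal_box stdZ mB).
rewrite [X in _ = (X * _)%E](standard_normal_box stdZ mB').
rewrite [LHS](bigD1 j)//= [X in _ = (X * _)%E](bigD1 j)//= /B' eqxx.
rewrite probability_setT mul1e muleC; congr (_ * _)%E.
by apply: eq_bigr => i /negbTE ->.
Qed.

Lemma measurable_hyperplane (R : realType) (n : nat) (a : 'rV[R]_n) :
  measurable [set t : n.-tuple R | (a *m tuple_cV t) 0 0 = 0].
Proof.
have mf := random_vector_mulmx a (@random_vector_tuple_cV R n).
by have := mf 0 measurableT [set 0] (measurable_set1 0); rewrite setTI.
Qed.

Lemma normal_prob_set1 (R : realType) (m s x : R) :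
  normal_prob m s [set x] = 0.
Proof.
have /null_content_dominatesP := @normal_prob_dominates R m s.
by apply => //; exact: lebesgue_measure_set1.
Qed.

(** After the coordinate [j], with [a_j <> 0], is resampled, the section of the
    hyperplane over a value of the other coordinates is a single point, which is
    null for the normal law. Integrating over the sections gives 0. *)
Lemma standard_normal_hyperplane (R : realType) (d : measure_display)
    (T : measurableType d) (P : probability T R) (l : nat)
    (Z : T -> 'cV[R]_l) (a : 'rV[R]_l) :
  standard_normal_vector P Z -> a != 0 ->
  P [set w | (a *m Z w) 0 0 = 0] = 0.
Proof.
move=> stdZ /rV0Pn[j aj0].
have mH := measurable_hyperplane a.
rewrite (same_law_cV (A := [set v | (a *m v) 0 0 = 0])
  (standard_normal_resample j stdZ) mH).
apply: integral0_eq => w _ /=.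
rewrite (_ : xsection _ w =
    [set - (\sum_(i | i != j) a 0 i * Z w i 0) / a 0 j]).
  exact: normal_prob_set1.
have lineE x : (a *m (\col_i if i == j then x else Z w i 0)) 0 0 =
    a 0 j * x + \sum_(i | i != j) a 0 i * Z w i 0.
  rewrite mxE (bigD1 j)//= mxE eqxx; congr (_ + _).
  by apply: eq_bigr => i /negbTE ij; rewrite mxE ij.
apply/seteqP; split => x; rewrite /xsection /= inE /= lineE.
  by move/eqP; rewrite addr_eq0 => /eqP <-; rewrite mulrAC divff// mul1r.
by move=> ->; rewrite mulrCA divff// mulr1 addNr.
Qed.

(** * Symmetry and means *)

Lemma same_law_map (R : realType) (d d' : measure_display)
    (T : measurableType d) (T' : measurableType d')
    (P : probability T R) (Q : probability T' R) (m n : nat)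
    (V : T -> 'cV[R]_m) (W : T' -> 'cV[R]_m) (f : 'cV[R]_m -> 'cV[R]_n) :
  same_law P Q V W -> random_vector (f \o tuple_cV) ->
  same_law P Q (f \o V) (f \o W).
Proof.
move=> PQ /measurable_cV_tuple mf B mB.
apply: (same_law_cV (A := [set v | B (cV_tuple (f v))]) PQ).
by have := mf measurableT B mB; rewrite setTI.
Qed.

Lemma same_law_expectation (R : realType) (d d' : measure_display)
    (T : measurableType d) (T' : measurableType d')
    (P : probability T R) (Q : probability T' R) (n : nat)
    (V : T -> 'cV[R]_n) (W : T' -> 'cV[R]_n) (g : 'cV[R]_n -> R) :
  same_law P Q V W -> random_vector V -> random_vector W ->
  measurable_fun setT (g \o tuple_cV) ->
  P.-integrable setT (EFin \o (g \o V)) ->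
  Q.-integrable setT (EFin \o (g \o W)) ->
  ('E_P[g \o V] = 'E_Q[g \o W])%E.
Proof.
move=> PQ /measurable_cV_tuple mV /measurable_cV_tuple mW mg iV iW.
have mg' := measurableT_comp (@EFin_measurable R setT) mg.
have gVE : EFin \o (g \o V) =
    (EFin \o (g \o tuple_cV)) \o (fun w => cV_tuple (V w)).
  by apply/funext => w /=; rewrite cV_tupleK.
have gWE : EFin \o (g \o W) =
    (EFin \o (g \o tuple_cV)) \o (fun w => cV_tuple (W w)).
  by apply/funext => w /=; rewrite cV_tupleK.
rewrite gVE in iV; rewrite gWE in iW.
rewrite unlock -[LHS]/(integral P setT (EFin \o (g \o V))).
rewrite -[RHS]/(integral Q setT (EFin \o (g \o W))) gVE gWE.
rewrite -[LHS](integral_pushforward mV mg' iV measurableT).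
rewrite -[RHS](integral_pushforward mW mg' iW measurableT).
by apply: eq_measure_integral => A mA _; exact: PQ.
Qed.

(** [E g(V) = E g(- V) = - E g(V)]; oddness is only required almost surely, to
    allow for a null set where [g] takes the wrong value. *)
Lemma expectation_odd (R : realType) (d : measure_display)
    (T : measurableType d) (P : probability T R) (n : nat)
    (V : T -> 'cV[R]_n) (g : 'cV[R]_n -> R) :
  same_law P P V (fun w => - V w) -> random_vector V ->
  measurable_fun setT (g \o tuple_cV) ->
  P.-integrable setT (EFin \o (g \o V)) ->
  P.-integrable setT (EFin \o (fun w => g (- V w))) ->
  {ae P, forall w, g (- V w) = - g (V w)} ->
  ('E_P[g \o V] = 0)%E.
Proof.
move=> symV mV mg iV iNV gN.
have E1 := same_law_expectation (g := g) symV mV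
  (random_vectorN mV) mg iV iNV.
have E2 : ('E_P[g \o (fun w => - V w)%R] = - 'E_P[g \o V])%E.
  rewrite unlock -integralN /=; last exact: integrable_add_def.
  apply: ae_eq_integral => //.
  - exact: (measurable_int _ iNV).
  - apply/measurable_EFinP/measurableT_comp => //.
    by apply/measurable_EFinP; exact: measurable_int iV.
  - by apply: filterS gN => w /= ->.
have : ('E_P[g \o V] \is a fin_num)%E.
  by rewrite unlock; exact: integrable_fin_num.
move: E2; rewrite -E1; case: ('E_P[g \o V])%E => //= r [] /eqP.
by rewrite -addr_eq0 -mulr2n mulrn_eq0 /= => /eqP ->.
Qed.

Lemma has_mean_mulmx (R : realType) (d : measure_display)
    (T : measurableType d) (P : probability T R) (m n : nat)
    (A : 'M[R]_(m, n)) (V : T -> 'cV[R]_n) (mu : 'cV[R]_n) :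
  has_mean P V mu -> has_mean P (fun w => A *m V w) (A *m mu).
Proof.
move=> hV i.
have E : EFin \o vcoord (fun w => A *m V w) i =
    fun w => (\sum_j (A i j)%:E * (EFin \o vcoord V j) w)%E.
  by apply/funext => w; rewrite /= /vcoord mxE -sumEFin.
have iV j : P.-integrable setT (fun w => ((A i j)%:E * (EFin \o vcoord V j) w)%E).
  by apply: integrableZl => //; case: (hV j).
split; first by rewrite E; apply: integrable_sum => // j _; exact: iV.
rewrite unlock -[LHS]/(integral P setT (EFin \o vcoord (fun w => A *m V w) i)) E.
rewrite integral_sum// mxE -sumEFin; apply: eq_bigr => j _.
have [iVj] := hV j; rewrite unlock => EVj.
by rewrite integralZl// [X in (_ * X)%E]EVj EFinM.
Qed.

Lemma has_meanD (R : realType) (d : measure_display)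
    (T : measurableType d) (P : probability T R) (n : nat)
    (V W : T -> 'cV[R]_n) (mu nu : 'cV[R]_n) :
  has_mean P V mu -> has_mean P W nu -> has_mean P (fun w => V w + W w) (mu + nu).
Proof.
move=> hV hW i; have [iV EV] := hV i; have [iW EW] := hW i.
have -> : vcoord (fun w => V w + W w) i = vcoord V i \+ vcoord W i.
  by apply/funext => w; rewrite /vcoord /= mxE.
split; first exact: (integrableD measurableT iV iW).
by rewrite expectationD ?EV ?EW ?mxE//; exact/Lfun1_integrable.
Qed.

Lemma has_mean_cst (R : realType) (d : measure_display)
    (T : measurableType d) (P : probability T R) (n : nat) (v : 'cV[R]_n) :
  has_mean P (fun _ => v) v.
Proof.
move=> i; split; last exact: expectation_cst.
exact: finite_measure_integrable_cst.
Qed.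

(** The shift [m] of the representation [m + A Z] is the center of symmetry of
    the law of [V]: [V] and [2 m - V] have the same law. Comparing the means of
    these two vectors gives [m = 0], without computing a moment of [Z]. *)
Lemma centered_normal_vectorP (R : realType) (d : measure_display)
    (T : measurableType d) (P : probability T R) (n : nat)
    (V : T -> 'cV[R]_n) :
  normal_vector P V -> has_mean P V 0 ->
  exists (l : nat) (A : 'M[R]_(n, l)) (d' : measure_display)
    (T' : measurableType d') (Q : probability T' R) (Z : T' -> 'cV[R]_l),
    standard_normal_vector Q Z /\ same_law P Q V (fun w => A *m Z w).
Proof.
move=> [mV [l [m [A [d' [T' [Q [Z [stdZ lawV]]]]]]]]] meanV.
exists l, A, d', T', Q, Z; split=> //.
suff m0 : m = 0 by move: lawV; rewrite m0; under eq_fun do rewrite add0r.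
have reflV : same_law P P V (fun w => (m + m) + (- 1%:M) *m V w).
  move=> B mB; rewrite lawV//.
  have affT : forall p q (b : 'cV[R]_p) (C : 'M[R]_(p, q)),
      random_vector ((fun v => b + C *m v) \o tuple_cV).
    move=> p q b C; apply: random_vectorD; first exact: random_vector_cst.
    by apply: random_vector_mulmx; exact: random_vector_tuple_cV.
  have H1 := same_law_map
    (standard_normal_sym stdZ) (affT _ _ m A).
  have H2 := same_law_map
    lawV (affT _ _ (m + m) (- 1%:M)).
  rewrite (H1 B mB) (H2 B mB); congr (Q _); apply: eq_set => w /=.
  by rewrite mulNmx mul1mx mulmxN opprD addrA addrK.
have mean1 := has_meanD
  (@has_mean_cst R d T P n (m + m)) (has_mean_mulmx (- 1%:M) meanV).
apply/colP => i; have [iV EV] := meanV i; have [iW EW] := mean1 i.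
have mW : random_vector (fun w => (m + m) + (- 1%:M) *m V w).
  by apply: random_vectorD; [exact: random_vector_cst|exact: random_vector_mulmx].
have : ('E_P[vcoord V i] =
        'E_P[vcoord (fun w => (m + m) + (- 1%:M) *m V w)%R i])%E :=
  same_law_expectation (g := fun v => v i 0) reflV mV mW
    (@random_vector_tuple_cV R n i) iV iW.
rewrite EV EW => -[] /esym/eqP; rewrite mulmx0 !mxE addr0 -mulr2n mulrn_eq0 /=.
by move/eqP.
Qed.

Lemma centered_normal_sym (R : realType) (d : measure_display)
    (T : measurableType d) (P : probability T R) (n : nat)
    (V : T -> 'cV[R]_n) :
  normal_vector P V -> has_mean P V 0 -> same_law P P V (fun w => - V w).
Proof.
move=> nV meanV.
have [l [A [d' [T' [Q [Z [stdZ lawV]]]]]]] :=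
  centered_normal_vectorP nV meanV.
have mA : random_vector (mulmx A \o tuple_cV).
  by apply: random_vector_mulmx; exact: random_vector_tuple_cV.
have mN : random_vector (-%R \o (@tuple_cV R n)).
  by apply: random_vectorN; exact: random_vector_tuple_cV.
have H1 := same_law_map
  (standard_normal_sym stdZ) mA.
have H2 := same_law_map lawV mN.
move=> B mB; rewrite lawV// (H1 B mB) (H2 B mB).
by congr (Q _); apply: eq_set => w /=; rewrite mulmxN.
Qed.

(** * Nondegenerate hyperplanes and norms *)

Lemma mulmx_trE (R : realType) (n : nat) (v : 'cV[R]_n) :
  (v^T *m v) 0 0 = \sum_i v i 0 ^+ 2.
Proof. by rewrite mxE; apply: eq_bigr => i _; rewrite mxE expr2. Qed.

(** If [u X^T X = 0] then [|X u^T|^2 = u X^T X u^T = 0]. *)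
Lemma gram_unit (R : realType) (n k : nat) (X : 'M[R]_(n, k)) :
  \rank X = k -> X^T *m X \in unitmx.
Proof.
move=> rX; have fX : row_free X^T by rewrite /row_free mxrank_tr rX.
rewrite -row_free_unit; apply/inj_row_free => u uG0.
apply: (row_free_inj fX); rewrite mul0mx.
have : ((X *m u^T)^T *m (X *m u^T)) 0 0 = 0.
  by rewrite trmx_mul trmxK -mulmxA (mulmxA X^T) mulmxA uG0 mul0mx mxE.
rewrite mulmx_trE => /eqP; rewrite psumr_eq0 => [/allP z|i _]; last exact: sqr_ge0.
rewrite -[LHS]trmxK trmx_mul trmxK; apply/matrixP => i j.
have := z j (mem_index_enum j); rewrite sqrf_eq0 => /eqP.
by rewrite !mxE (ord1 i).
Qed.

Lemma measurable_euclidean_norm (R : realType) (d : measure_display)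
    (T : measurableType d) (n : nat) (V : T -> 'cV[R]_n) :
  random_vector V ->
  measurable_fun setT (fun w => Num.sqrt (((V w)^T *m V w) 0 0)).
Proof.
move=> mV; under eq_fun do rewrite mulmx_trE.
apply: (measurableT_comp (continuous_measurable_fun (@sqrt_continuous R))).
by apply: measurable_sum => i; apply: measurable_funX; exact: mV.
Qed.

(** The norm is at most the sum of the absolute values of the coordinates. *)
Lemma integrable_euclidean_norm (R : realType) (d : measure_display)
    (T : measurableType d) (P : probability T R) (n : nat)
    (V : T -> 'cV[R]_n) (mu : 'cV[R]_n) :
  has_mean P V mu ->
  P.-integrable setT (fun w => (Num.sqrt (((V w)^T *m V w) 0 0))%:E).
Proof.
move=> meanV.
have mV : random_vector V.
  by move=> i; apply/measurable_EFinP; exact: measurable_int (meanV i).1.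
apply: (@le_integrable _ _ _ _ _ _ _
  (fun w => (\sum_(i < n) `|(EFin \o vcoord V i) w|)%E)) => //.
- by apply/measurable_EFinP; exact: measurable_euclidean_norm.
- move=> w _; rewrite [X in (_ <= `|X|)%E](_ : _ = (\sum_(i < n) `|V w i 0|)%:E).
    have S0 : 0 <= \sum_(i < n) `|V w i 0| by apply: sumr_ge0.
    rewrite /= lee_fin ger0_norm ?sqrtr_ge0// (ger0_norm S0).
    rewrite -[leRHS]ger0_norm// -sqrtr_sqr ler_sqrt ?sqr_ge0// mulmx_trE.
    rewrite expr2 mulr_sumr; apply: ler_sum => i _.
    rewrite -real_normK ?num_real// expr2 ler_wpM2r//.
    by rewrite (bigD1 i)//= lerDl sumr_ge0.
  by rewrite -sumEFin.
- apply: integrable_sum => // i _.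
  by apply: integrable_abse; exact: (meanV i).1.
Qed.

(** If [c V = 0] almost surely then [E ((c V) V_j) = 0], whereas the covariance
    gives [c_j * s], which is nonzero for some [j]. *)
Lemma cov_not_degenerate (R : realType) (d : measure_display)
    (T : measurableType d) (P : probability T R) (n : nat)
    (V : T -> 'cV[R]_n) (s : R) (c : 'rV[R]_n) :
  has_mean P V 0 -> has_cov P V (s *: 1%:M) -> s != 0 -> c != 0 ->
  ~ {ae P, forall w, (c *m V w) 0 0 = 0}.
Proof.
move=> meanV covV s0 /rV0Pn[j cj0] cV0.
have mV i : measurable_fun setT (vcoord V i).
  by apply/measurable_EFinP; exact: measurable_int (meanV i).1.
have momE i l : (\int[P]_w (V w i 0 * V w l 0)%:E = (s * (i == l)%:R)%:E)%E.
  have := covV i l; rewrite unlock !(meanV _).2 !mxE /= unlock => <-.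
  apply: eq_integral => w _; rewrite /=.
  by rewrite -[RHS]/((vcoord V i w - 0) * (vcoord V l w - 0))%:E !subr0.
(* A finite expectation says nothing of integrability in general, but it does
   for the nonnegative functions [V_i ^+ 2], and these dominate the products. *)
have isq i : P.-integrable setT (fun w => (V w i 0 ^+ 2)%:E).
  apply/integrableP; split.
    by apply/measurable_EFinP; apply: measurable_funX; exact: mV.
  under eq_integral do rewrite gee0_abs ?lee_fin ?sqr_ge0// expr2.
  by rewrite momE ltry.
have imul i l : P.-integrable setT (fun w => (V w i 0 * V w l 0)%:E).
  apply: le_integrable (integrableD measurableT (isq i) (isq l)) => //.
    by apply/measurable_EFinP; apply: measurable_funM; exact: mV.
  move=> w _; rewrite /= lee_fin [leRHS]ger0_norm ?addr_ge0 ?sqr_ge0//.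
  rewrite normrM -(real_normK (num_real (V w i 0))).
  rewrite -(real_normK (num_real (V w l 0))).
  set a := `|V w i 0|; set b := `|V w l 0|.
  apply: (@le_trans _ _ (a * b *+ 2)).
    by rewrite mulr2n lerDl mulr_ge0 ?normr_ge0.
  by rewrite -subr_ge0 addrAC -sqrrB sqr_ge0.
have icmul i : P.-integrable setT (fun w => ((c 0 i)%:E * (V w i 0 * V w j 0)%:E)%E).
  exact: integrableZl.
have : (\int[P]_w (\sum_i ((c 0 i)%:E * (V w i 0 * V w j 0)%:E)) = (c 0 j * s)%:E)%E.
  rewrite integral_sum// (bigD1 j)//= integralZl// momE eqxx mulr1.
  rewrite big1 ?adde0// => i /negbTE ij.
  by rewrite integralZl// momE ij mulr0 mule0.
rewrite (ae_eq_integral (cst 0%E))//=.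
- by rewrite integral0 => -[] /esym/eqP; rewrite mulf_eq0 (negbTE cj0) (negbTE s0).
- exact: (measurable_int _ (integrable_sum measurableT (index_enum 'I_n)
    (P := xpredT) (fun i _ => icmul i))).
- apply: filterS cV0 => w cVw _ /=.
  under eq_bigr do rewrite -EFinM mulrA.
  by rewrite sumEFin -mulr_suml; move: cVw; rewrite mxE => ->; rewrite mul0r.
Qed.

Lemma centered_normal_hyperplane (R : realType) (d : measure_display)
    (T : measurableType d) (P : probability T R) (n : nat)
    (V : T -> 'cV[R]_n) (s : R) (c : 'rV[R]_n) :
  normal_vector P V -> has_mean P V 0 -> has_cov P V (s *: 1%:M) ->
  s != 0 -> c != 0 -> P [set w | (c *m V w) 0 0 = 0] = 0.
Proof.
move=> nV meanV covV s0 c0.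
have [l [A [d' [T' [Q [Z [stdZ lawV]]]]]]] := centered_normal_vectorP nV meanV.
have PH : P [set w | (c *m V w) 0 0 = 0] = Q [set w | (c *m A *m Z w) 0 0 = 0].
  rewrite (same_law_cV (A := [set v | (c *m v) 0 0 = 0]) lawV); last first.
    exact: measurable_hyperplane.
  by congr (Q _); apply: eq_set => w /=; rewrite mulmxA.
have [cA0|cA0] := eqVneq (c *m A) 0; last first.
  by rewrite PH; exact: standard_normal_hyperplane.
exfalso; apply: (cov_not_degenerate meanV covV s0 c0).
have mH : measurable [set w | (c *m V w) 0 0 = 0].
  have := random_vector_mulmx c nV.1 0 measurableT (measurable_set1 0).
  by rewrite setTI.
exists (~` [set w | (c *m V w) 0 0 = 0]); split => //; first exact: measurableC.
rewrite probability_setC// PH cA0.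
rewrite (_ : [set w | _] = setT) ?probability_setT ?subee//.
by apply/seteqP; split => w //= _; rewrite mul0mx mxE.
Qed.

(** * The signed norm and the estimator *)

Lemma normr_sign1 (R : realType) (x : R) : `|sign1 x| = 1.
Proof. by rewrite /sign1; case: ifP => _; rewrite ?normrN normr1. Qed.

Lemma sign1N (R : realType) (x : R) : x != 0 -> sign1 (- x) = - sign1 x.
Proof.
by rewrite /sign1 oppr_ge0 neq_lt => /orP[] x0;
  rewrite (lt_geF x0) (ltW x0) ?opprK.
Qed.

Definition signed_norm (R : realType) (m n : nat) (c : 'rV[R]_n)
    (M : 'M[R]_(m, n)) (v : 'cV[R]_n) : R :=
  sign1 ((c *m v) 0 0) * Num.sqrt (((M *m v)^T *m (M *m v)) 0 0).

Lemma measurable_signed_norm (R : realType) (d : measure_display)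
    (T : measurableType d) (m n : nat) (c : 'rV[R]_n) (M : 'M[R]_(m, n))
    (V : T -> 'cV[R]_n) :
  random_vector V -> measurable_fun setT (fun w => signed_norm c M (V w)).
Proof.
move=> mV; apply: measurable_funM; last first.
  exact: measurable_euclidean_norm (random_vector_mulmx M mV).
apply: measurable_fun_ifT => //.
by apply: measurable_fun_ler => //; exact: (random_vector_mulmx c mV 0).
Qed.

Lemma integrable_signed_norm (R : realType) (d : measure_display)
    (T : measurableType d) (P : probability T R) (m n : nat) (c : 'rV[R]_n)
    (M : 'M[R]_(m, n)) (V : T -> 'cV[R]_n) (mu : 'cV[R]_n) :
  has_mean P V mu ->
  P.-integrable setT (EFin \o (fun w => signed_norm c M (V w))).
Proof.
move=> meanV.
apply: le_integrable
  (integrable_euclidean_norm (has_mean_mulmx M meanV)) => //.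
  apply/measurable_EFinP; apply: measurable_signed_norm => i.
  by apply/measurable_EFinP; exact: measurable_int (meanV i).1.
by move=> w _; rewrite /= lee_fin normrM normr_sign1 mul1r.
Qed.

(** The signed norm is odd except on [c v = 0], where [sign1 (c v)]
    and [sign1 (c (- v))] are both 1. *)
Lemma expectation_signed_norm (R : realType) (d : measure_display)
    (T : measurableType d) (P : probability T R) (m n : nat) (s : R)
    (c : 'rV[R]_n) (M : 'M[R]_(m, n)) (V : T -> 'cV[R]_n) :
  normal_vector P V -> has_mean P V 0 -> has_cov P V (s *: 1%:M) ->
  s != 0 -> c != 0 -> ('E_P[fun w => signed_norm c M (V w)] = 0)%E.
Proof.
move=> nV meanV covV s0 c0.
have meanNV : has_mean P (fun w => - V w) (- 1%:M *m 0).
  have := has_mean_mulmx (- 1%:M) meanV.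
  by under eq_fun do rewrite mulNmx mul1mx.
apply: (@expectation_odd _ _ _ _ _ V (signed_norm c M)).
- exact: centered_normal_sym.
- by case: nV.
- exact: measurable_signed_norm (@random_vector_tuple_cV R n).
- exact: integrable_signed_norm meanV.
- exact: integrable_signed_norm meanNV.
exists [set w | (c *m V w) 0 0 = 0]; split.
- have := random_vector_mulmx c nV.1 0 measurableT (measurable_set1 0).
  by rewrite setTI.
- exact: (centered_normal_hyperplane nV meanV covV s0 c0).
- move=> w /=; apply: contra_notP => /eqP cV0.
  by rewrite /signed_norm !mulmxN linearN /= mulNmx opprK mxE sign1N// mulNr.
Qed.

Lemma has_mean_scale0 (R : realType) (d : measure_display)
    (T : measurableType d) (P : probability T R) (n : nat) (g : T -> R)
    (v : 'cV[R]_n) :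
  P.-integrable setT (EFin \o g) -> ('E_P[g] = 0)%E ->
  has_mean P (fun w => g w *: v) 0.
Proof.
move=> ig Eg i.
have E : vcoord (fun w => g w *: v) i = v i 0 \o* g.
  by apply/funext => w; rewrite /vcoord /= !mxE.
have lg : g \in Lfun P 1 by exact/Lfun1_integrable.
rewrite E; split; first by apply/Lfun1_integrable; exact: Lfun_scale.
by rewrite expectationZl// Eg mule0 mxE.
Qed.

Unset Implicit Arguments.

Theorem proposition4 (R : realType) (n k : nat) (hk : (1 <= k)%N)
    (hkn : (k < n)%N)
    (X : 'M[R]_(n, k)) (hX : \rank X = k) (beta : 'cV[R]_k)
    (d : measure_display) (T : measurableType d) (P : probability T R)
    (sigma2 : R) (hsigma2 : 0 < sigma2)
    (eps : T -> 'cV[R]_n) (heps : normal_vector P eps)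
    (hmean : has_mean P eps 0) (hcov : has_cov P eps (sigma2 *: 1%:M))
    (Y : T -> 'cV[R]_n) (hY : forall w, Y w = X *m beta + eps w)
    (lambda1 : R) (hlambda1 : max_eigenvalue (invmx (X^T *m X)) lambda1)
    (z1 : 'cV[R]_k) (hz1 : invmx (X^T *m X) *m z1 = lambda1 *: z1)
    (hz1n : z1^T *m z1 = 1%:M) :
  has_mean P (fun w => optimal_quasi_estimator X beta lambda1 z1 (Y w)) beta.
Proof.
have uG := gram_unit hX.
set H := invmx (X^T *m X) *m X^T.
have HX : H *m X = 1%:M by rewrite -mulmxA mulVmx.
have olsY w : ols X (Y w) = beta + H *m eps w.
  by rewrite hY /ols -/H mulmxDr mulmxA HX mul1mx.
have resY w : residual X (Y w) = (1%:M - X *m H) *m eps w.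
  rewrite /residual olsY hY mulmxDr mulmxBl mul1mx mulmxA.
  by rewrite opprD addrACA subrr add0r.
(* [z1^T H = 0] would give [z1^T = z1^T H X = 0], but [z1] is a unit vector. *)
have c0 : z1^T *m H != 0.
  apply/eqP => /(congr1 (mulmx^~ X)); rewrite -mulmxA HX mulmx1 mul0mx => z0.
  by move: hz1n; rewrite z0 mul0mx => /esym/eqP; rewrite oner_eq0.
have s0 : sigma2 != 0 by rewrite gt_eqF.
pose M := 1%:M - X *m H.
set K := Num.sqrt (lambda1 / pi) *
  (Gamma ((n - k + 1)%N%:R / 2) / Gamma ((n - k + 2)%N%:R / 2)).
have -> : (fun w => optimal_quasi_estimator X beta lambda1 z1 (Y w)) =
    (fun w => beta + H *m eps w +
       signed_norm (z1^T *m H) M (eps w) *: (- K *: z1)).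
  apply/funext => w; rewrite /optimal_quasi_estimator resY olsY.
  rewrite (addrC beta) addrK mulmxA /signed_norm -/M.
  rewrite scalerA mulrN scaleNr; congr (_ - _ *: _).
  by rewrite [RHS]mulrAC; congr (_ * _); rewrite /K !mulrA.
have := has_meanD (has_meanD (@has_mean_cst R d T P k beta)
    (has_mean_mulmx H hmean))
  (has_mean_scale0 (- K *: z1) (integrable_signed_norm (z1^T *m H) M hmean)
    (expectation_signed_norm M heps hmean hcov s0 c0)).
by rewrite mulmx0 !addr0.
Qed.
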